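(* Let $0<q<1$, let $A>0$ and $t>0$ be real, and put $x=-q^t/A$ (equivalently, let $A>0$ and $-1/A<x<0$). Then $$(1-q)_q^\infty(1-x)_q^\infty(1-q/x)_q^\infty=(1+qA)_q^\infty(1+Ax)_q^\infty\sum_{n=-\infty}^\infty(-x)^nA^n\Big(1+\frac1A\Big)_q^n.$$
   Context: Notation, for $0<q<1$: $(1+a)_q^\infty=\prod_{j=0}^\infty(1+q^ja)$ and, for any integer $n$ (positive, zero or negative), $(1+a)_q^n=\dfrac{(1+a)_q^\infty}{(1+q^na)_q^\infty}$. Thus $(1-q)_q^\infty=\prod_{j\ge0}(1-q^{j+1})$, $(1-x)_q^\infty=\prod_{j\ge 0}(1-q^jx)$, etc. *)

(* Defs.v *)
From HB Require Import structures.
From mathcomp Require Import all_boot all_order all_algebra.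
From mathcomp Require Import all_classical all_reals all_analysis.
Import Order.TTheory GRing.Theory Num.Theory.
Import numFieldNormedType.Exports.

Set Implicit Arguments.
Unset Strict Implicit.
Unset Printing Implicit Defensive.

Local Open Scope classical_set_scope.
Local Open Scope ring_scope.

(* [qprod_inf q a] is $(1+a)_q^\infty$; thus $(1-x)_q^\infty$ is
   [qprod_inf q (- x)].  For 0 < q < 1 the partial products converge for
   every a, so the limit is never a default value. *)
Definition qprod_inf (R : realType) (q a : R) : R :=
  limn (fun N : nat => \prod_(0 <= j < N) (1 + q ^+ j * a)).

(* [qprod q a n] is $(1+a)_q^n$, for an integer n of either sign. *)
Definition qprod (R : realType) (q a : R) (n : int) : R :=
  qprod_inf q a / qprod_inf q (q ^ n * a).

(* A series over all integers is split into the indices n >= 0 and the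
   indices n = -(m+1), m >= 0; both one-sided series have to converge. *)
Definition bilateral_cvg (R : realType) (u : int -> R) : Prop :=
  cvgn (series (fun m : nat => u m%:Z)) /\
  cvgn (series (fun m : nat => u (- m.+1%:Z))).

Definition bilateral_sum (R : realType) (u : int -> R) : R :=
  limn (series (fun m : nat => u m%:Z)) +
  limn (series (fun m : nat => u (- m.+1%:Z))).

(* Main.v *)
(** With [a = 1/A] and [z = - A x], the identity is Ramanujan's summation of
    1psi1(-a; b; q, z) at [b = 0].  For [b = q^(m+1)] the bilateral series is
    the q-binomial series sum_k (1+c)_q^k / (1-q)_q^k z^k with [c = q^-m a],
    shifted by [m], so the q-binomial theorem sums it; the case [b = 0] is the
    limit [m -> oo], taken by dominated convergence.  All terms are positive,
    and the closed forms are bounded in [m], which also yields the convergence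
    of the half of the series with negative indices.  The q-binomial theorem
    itself follows by iterating (1 - z) F(z) = (1 + c z) F(q z), with F
    continuous at 0. *)

Require Import Defs.
From HB Require Import structures.
From mathcomp Require Import all_boot all_order all_algebra.
From mathcomp Require Import all_classical all_reals all_analysis.
From mathcomp Require Import ring lra.
Import Order.TTheory GRing.Theory Num.Theory.
Import numFieldNormedType.Exports.

Set Implicit Arguments.
Unset Strict Implicit.
Unset Printing Implicit Defensive.

Local Open Scope ring_scope.
Local Open Scope classical_set_scope.

(** * Limits of series: tails and dominated convergence *)

Lemma cvg_sum_nat (R : realType) (f : nat -> nat -> R) (F : nat -> R) N :
  (forall n, f ^~ n @ \oo --> F n) ->
  (fun m => series (f m) N) @ \oo --> series F N.
Proof.
move=> fF; elim: N => [|N IH].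
  by rewrite /series /= big_geq //; under eq_fun do rewrite big_geq //;
    exact: cvg_cst.
rewrite seriesSr; under eq_fun do rewrite seriesSr.
exact: cvgD.
Qed.

(** The partial sums of the series of [g - h] are nondecreasing, hence stay below their limit. *)
Lemma le_series_tail (R : realType) (h g : R^nat) (l : R) N :
  (forall n, h n <= g n) -> cvgn (series g) -> series h @ \oo --> l ->
  l - series h N <= limn (series g) - series g N.
Proof.
move=> hg cg hl.
have key : series (g - h) @ \oo --> limn (series g) - l.
  by rewrite seriesD seriesN; apply: cvgB.
have nd : nondecreasing_seq (series (g - h)).
  by apply: nondecreasing_series => n _ _; rewrite subr_ge0.
have := nondecreasing_cvgn_le nd (cvgP _ key) N.
rewrite (cvg_lim _ key) // seriesD seriesN => /=.
rewrite -[X in X <= _]/(series g N - series h N); lra.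
Qed.

(** Cut at an [N] where the tail of [g] is below [e / 2]. The tails of [f m] and of [F] then both
    lie in [[0, e / 2)], so they differ by less than [e / 2]; the heads do so too for large [m]. *)
Lemma tannery_series (R : realType) (f : nat -> nat -> R) (F g s : R^nat)
    (S : R) :
  (forall m n, 0 <= f m n) -> (forall m n, f m n <= g n) ->
  cvgn (series g) -> (forall n, f ^~ n @ \oo --> F n) ->
  (forall m, series (f m) @ \oo --> s m) -> series F @ \oo --> S ->
  s @ \oo --> S.
Proof.
move=> f0 fg cg fF fs FS.
have F0 n : 0 <= F n.
  rewrite -(cvg_lim _ (fF n)) //; apply: limr_ge; first exact: cvgP (fF n).
  exact: nearW.
have Fg n : F n <= g n.
  rewrite -(cvg_lim _ (fF n)) //; apply: limr_le; first exact: cvgP (fF n).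
  exact: nearW.
apply/cvgrPdist_lt => e e0.
have e2 : 0 < e / 2 by rewrite divr_gt0.
have [N gN] : exists N, limn (series g) - series g N < e / 2.
  have /cvgrPdist_lt/(_ _ e2)[N _ HN] : series g @ \oo --> limn (series g) by [].
  by exists N; apply: le_lt_trans (ler_norm _) (HN N _) => /=.
have head (h : R^nat) (l : R) : (forall n, 0 <= h n) -> series h @ \oo --> l ->
    series h N <= l.
  move=> h0 hl; have nd : nondecreasing_seq (series h).
    by apply: nondecreasing_series => n _ _.
  by have := nondecreasing_cvgn_le nd (cvgP _ hl) N; rewrite (cvg_lim _ hl).
have /cvgrPdist_lt/(_ _ e2) := @cvg_sum_nat _ _ _ N fF.
apply: filterS => m; rewrite !ltr_distl => /andP[l1 l2].
have := head _ _ (f0 m) (fs m); have := head _ _ F0 FS.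
have := le_series_tail N (fg m) cg (fs m).
have := le_series_tail N Fg cg FS.
move=> *; apply/andP; split; lra.
Qed.

Lemma series_le_is_cvg (R : realType) (u : R^nat) (M : R) :
  (forall n, 0 <= u n) -> (forall n, series u n <= M) -> cvgn (series u).
Proof.
move=> u0 uM; apply: nondecreasing_is_cvgn; first exact: nondecreasing_series.
by exists M => _ [n _ <-].
Qed.

(** * Finite and infinite q-products *)

Definition qprod_fin (R : realType) (q a : R) (N : nat) : R :=
  \prod_(0 <= j < N) (1 + q ^+ j * a).

Section QProducts.
Variables (R : realType) (q : R).
Hypotheses (q_gt0 : 0 < q) (q_lt1 : q < 1).
Let q_neq0 : q != 0. Proof. exact: lt0r_neq0. Qed.
Local Notation P := (qprod_fin q).
Local Notation Pinf := (qprod_inf q).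

Lemma qprod_fin0 a : P a 0 = 1. Proof. by rewrite /qprod_fin big_geq. Qed.

Lemma qprod_finS a N : P a N.+1 = P a N * (1 + q ^+ N * a).
Proof. by rewrite /qprod_fin big_nat_recr. Qed.

Lemma qprod_finD a m N : P a (m + N) = P a m * P (q ^+ m * a) N.
Proof.
elim: N => [|N IH]; first by rewrite addn0 qprod_fin0 mulr1.
by rewrite addnS !qprod_finS IH exprD; ring.
Qed.

Lemma qpow_in01 j : 0 < q ^+ j <= 1.
Proof. by rewrite exprn_gt0 // exprn_ile1 // ltW. Qed.

Lemma qfactor_gt0 a j : -1 < a -> 0 < 1 + q ^+ j * a.
Proof. by move=> a1; have /andP[] := qpow_in01 j => *; nra. Qed.

Lemma qprod_fin_gt0 a N : -1 < a -> 0 < P a N.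
Proof. by move=> a1; apply: prodr_gt0 => j _; exact: qfactor_gt0. Qed.

Lemma qprod_fin_nd a : 0 <= a -> nondecreasing_seq (P a).
Proof.
move=> a0; apply/nondecreasing_seqP => n; rewrite qprod_finS ler_peMr //.
  by rewrite ltW // qprod_fin_gt0 // (lt_le_trans _ a0) // ltrN10.
by rewrite lerDl mulr_ge0 // exprn_ge0 // ltW.
Qed.

Lemma qprod_fin_ni a : -1 < a -> a <= 0 -> nonincreasing_seq (P a).
Proof.
move=> a1 a0; apply/nonincreasing_seqP => n; rewrite qprod_finS ler_piMr //.
  by rewrite ltW // qprod_fin_gt0.
by rewrite gerDl mulr_ge0_le0 // exprn_ge0 // ltW.
Qed.

(** Each factor is at most [expR (a * q ^+ j)], and the exponents form a geometric series of sum
    [a / (1 - q)]. *)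
Lemma qprod_fin_le_exp a N : 0 <= a -> P a N <= expR (a / (1 - q)).
Proof.
move=> a0; have q1 : `|q| < 1 by rewrite gtr0_norm.
apply: (@le_trans _ _ (expR (series (geometric a q) N))); last first.
  by rewrite ler_expR geometric_le_lim.
elim: N => [|N IH]; first by rewrite qprod_fin0 /series /= big_geq // expR0.
rewrite qprod_finS seriesSr expRD ler_pM //.
- by rewrite ltW // qprod_fin_gt0 // (lt_le_trans _ a0) // ltrN10.
- by rewrite ltW // qfactor_gt0 // (lt_le_trans _ a0) // ltrN10.
- by rewrite mulrC; exact: expR_ge1Dx.
Qed.

(** Turns upper bounds for nonnegative parameters into positive lower bounds for negative ones. The
    parameter [- a / (1 + a)] makes the product of paired factors at least 1. *)
Lemma qprod_fin_neg_ge a N : -1 < a -> a <= 0 ->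
  (P (- a / (1 + a)) N)^-1 <= P a N.
Proof.
move=> a1 a0; have a1' : 0 < 1 + a by lra.
have b0 : 0 <= - a / (1 + a) by rewrite divr_ge0 ?oppr_ge0 // ltW.
have b1 : -1 < - a / (1 + a) by rewrite (lt_le_trans _ b0) // ltrN10.
rewrite -[leRHS]invrK lef_pV2 ?posrE ?invr_gt0 ?qprod_fin_gt0 //.
rewrite -[leLHS]mul1r ler_pdivrMr ?qprod_fin_gt0 // /qprod_fin -big_split /=.
elim/big_ind: _ => // [x y x1 y1|j _]; first by rewrite mulr_ege1.
have /andP[Q0 Q1] := qpow_in01 j; set Q := q ^+ j in Q0 Q1 *.
rewrite -subr_ge0.
have -> : (1 + Q * (- a / (1 + a))) * (1 + Q * a) - 1 = Q * (1 - Q) * (a ^+ 2) / (1 + a).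
  by field; rewrite gt_eqF.
apply: divr_ge0; last exact: ltW.
by rewrite mulr_ge0 ?sqr_ge0// mulr_ge0 ?subr_ge0// ltW.
Qed.

Lemma is_cvg_qprod_fin a : -1 < a -> cvgn (P a).
Proof.
move=> a1; have [a0|/ltW a0] := leP 0 a.
  apply: nondecreasing_is_cvgn; first exact: qprod_fin_nd.
  by exists (expR (a / (1 - q))) => _ [n _ <-]; exact: qprod_fin_le_exp.
apply: nonincreasing_is_cvgn; first exact: qprod_fin_ni.
by exists 0 => _ [n _ <-]; rewrite ltW // qprod_fin_gt0.
Qed.

Lemma cvg_qprod_fin a : -1 < a -> P a @ \oo --> Pinf a.
Proof. exact: is_cvg_qprod_fin. Qed.

Lemma qprod_fin_le_inf a N : 0 <= a -> P a N <= Pinf a.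
Proof.
move=> a0; apply: nondecreasing_cvgn_le; first exact: qprod_fin_nd.
by apply: is_cvg_qprod_fin; rewrite (lt_le_trans _ a0) // ltrN10.
Qed.

Lemma qprod_inf_le_fin a N : -1 < a -> a <= 0 -> Pinf a <= P a N.
Proof.
move=> a1 a0; apply: nonincreasing_cvgn_ge; first exact: qprod_fin_ni.
exact: is_cvg_qprod_fin.
Qed.

(** For negative [a] the partial products decrease, so their positivity alone does not pass to the
    limit; the inverse of an exponential bounds them below uniformly. *)
Lemma qprod_inf_gt0 a : -1 < a -> 0 < Pinf a.
Proof.
move=> a1; have [a0|/ltW a0] := leP 0 a.
  by rewrite (lt_le_trans _ (qprod_fin_le_inf 0 a0)) // qprod_fin0.
have a1' : 0 < 1 + a by lra.
have b0 : 0 <= - a / (1 + a) by rewrite divr_ge0 ?oppr_ge0 // ltW.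
apply: (@lt_le_trans _ _ (expR (- a / (1 + a) / (1 - q)))^-1).
  by rewrite invr_gt0 expR_gt0.
apply: limr_ge; first exact: is_cvg_qprod_fin.
apply: nearW => N; apply: le_trans (qprod_fin_neg_ge _ a1 a0).
rewrite lef_pV2 ?posrE ?expR_gt0 ?qprod_fin_le_exp//.
by rewrite qprod_fin_gt0// (lt_le_trans _ b0)// ltrN10.
Qed.

Lemma qprod_infD a m : -1 < a -> Pinf a = P a m * Pinf (q ^+ m * a).
Proof.
move=> a1; have a1' : -1 < q ^+ m * a by have := qfactor_gt0 m a1; lra.
apply: cvg_lim => //; rewrite -(cvg_shiftn m) /=.
under eq_fun => n do rewrite addnC -/(qprod_fin q a (m + n)) qprod_finD.
by apply: cvgMr; exact: cvg_qprod_fin.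
Qed.

Lemma qprodE_nat a (n : nat) : -1 < a -> qprod q a n = P a n.
Proof.
move=> a1; have a1' : -1 < q ^+ n * a by have := qfactor_gt0 n a1; lra.
by rewrite /qprod (qprod_infD n a1) mulfK // gt_eqF // qprod_inf_gt0.
Qed.

(** The infinite product in the denominator has parameter [q ^- n * a]; beyond its first [n] factors
    it equals the numerator. *)
Lemma qprodE_neg a (n : nat) : 0 <= a ->
  qprod q a (- n%:Z) = (P (q ^- n * a) n)^-1.
Proof.
move=> a0; have a1 : -1 < a by rewrite (lt_le_trans _ a0) // ltrN10.
have b1 : -1 < q ^- n * a.
  by rewrite (@lt_le_trans _ _ 0) ?ltrN10// mulr_ge0// invr_ge0 exprn_ge0// ltW.
rewrite /qprod -exprnN (qprod_infD n b1).
rewrite mulrA mulfV ?expf_neq0// mul1r invfM mulrCA mulfV ?mulr1//.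
by rewrite gt_eqF // qprod_inf_gt0.
Qed.

(** Reverse the order of the factors and use [1 + q^-(i+1) c = q^-(i+1) c (1 + q^i (q/c))]. The
    parameter [q ^- m * c], which grows with [m], gives way to the fixed [q / c]. *)
Lemma qprod_fin_reverse c m : c != 0 ->
  P (q ^- m * c) m = \prod_(0 <= i < m) (q ^- i.+1) * c ^+ m * P (q / c) m.
Proof.
move=> c0; have -> : c ^+ m = \prod_(0 <= i < m) c by rewrite big_const_nat subn0 iter_mulr_1.
rewrite /qprod_fin -!big_split /= big_nat_rev /= add0n.
apply: eq_big_nat => i /andP[_ im].
have -> : q ^- m = q ^- (m - i.+1) * q ^- i.+1.
  by rewrite -invfM -exprD subnK.
by rewrite exprS; field; rewrite q_neq0 c0 !expf_neq0.
Qed.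

End QProducts.

(** * The q-binomial theorem *)

Lemma cvg_series_expr0 (R : realType) (u : R^nat) :
  series (fun k => u k * 0 ^+ k) @ \oo --> u 0%N.
Proof.
(* The partial sum of length 0 is empty; from length 1 on all equal [u 0], because [0 ^+ 0 = 1]. *)
rewrite -(cvg_shiftS (series _)).
suff -> : [sequence series (fun k => u k * 0 ^+ k) n.+1]_n = fun=> u 0%N.
  exact: cvg_cst.
apply/funext => n /=; elim: n => [|n IH].
  by rewrite seriesSr /series /= big_geq // add0r expr0 mulr1.
by rewrite seriesSr IH expr0n mulr0 addr0.
Qed.

Section QBinomial.
Variables (R : realType) (q c : R).
Hypotheses (q_gt0 : 0 < q) (q_lt1 : q < 1) (c_ge0 : 0 <= c).
Local Notation P := (qprod_fin q).
Local Notation Pinf := (qprod_inf q).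

Definition qbinom_term (z : R) (k : nat) : R := P c k / P (- q) k * z ^+ k.

Let q_gtN1 : -1 < - q. Proof. by rewrite ltrN2. Qed.
Let q_le0 : - q <= 0. Proof. by rewrite oppr_le0 ltW. Qed.
Let c_gtN1 : -1 < c. Proof. by rewrite (lt_le_trans _ c_ge0) // ltrN10. Qed.

Let coef_ge0 k : 0 <= P c k / P (- q) k.
Proof. by rewrite divr_ge0 // ltW // qprod_fin_gt0. Qed.

Lemma qbinom_term_ge0 z k : 0 <= z -> 0 <= qbinom_term z k.
Proof. by move=> z0; rewrite mulr_ge0 // exprn_ge0. Qed.

(** [P c k] increases and [P (- q) k] decreases with [k], so the quotient of their limits bounds the
    coefficients and a geometric series dominates. *)
Lemma is_cvg_qbinom_series z : 0 <= z -> z < 1 ->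
  cvgn (series (qbinom_term z)).
Proof.
move=> z0 z1; pose M := Pinf c / Pinf (- q).
have M0 : 0 <= M by rewrite divr_ge0 // ltW // qprod_inf_gt0.
apply: (@series_le_cvg _ _ (geometric M z)).
- by move=> k; exact: qbinom_term_ge0.
- by move=> k /=; rewrite mulr_ge0 // exprn_ge0.
- move=> k /=; rewrite ler_wpM2r ?exprn_ge0 //.
  apply: ler_pM.
  + by rewrite ltW // qprod_fin_gt0.
  + by rewrite invr_ge0 ltW // qprod_fin_gt0.
  + exact: qprod_fin_le_inf.
  by rewrite lef_pV2 ?posrE ?qprod_fin_gt0 ?qprod_inf_gt0 ?qprod_inf_le_fin.
- by apply: is_cvg_geometric_series; rewrite ger0_norm.
Qed.

Definition qbinom_sum (z : R) : R := limn (series (qbinom_term z)).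

Lemma qbinom_sum_scale z : 0 <= z -> z < 1 ->
  (1 - z) * qbinom_sum z = (1 + c * z) * qbinom_sum (q * z).
Proof.
move=> z0 z1.
have qz0 : 0 <= q * z by rewrite mulr_ge0 // ltW.
have qz1 : q * z < 1 by rewrite (le_lt_trans _ z1) // ler_piMl // ltW.
have cz := is_cvg_qbinom_series z0 z1.
have cqz := is_cvg_qbinom_series qz0 qz1.
set u := qbinom_term z in cz; set v := qbinom_term (q * z) in cqz.
(* The factor [1 - q^(k+1)] produced by the difference cancels the last factor of [P (- q) k.+1],
   leaving [1 + q^k c] times the previous coefficient. *)
have step k : u k.+1 - v k.+1 = z * u k + c * z * v k.
  rewrite /u /v /qbinom_term !qprod_finS !exprMn !exprS.
  have h1 : P (- q) k != 0 by rewrite gt_eqF // qprod_fin_gt0.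
  have h2 : 1 + q ^+ k * (- q) != 0 by rewrite gt_eqF // qfactor_gt0.
  by field; rewrite h1.
(* The terms of index 0 of [u] and [v] are equal and cancel, hence the shift from [n.+1] to [n]. *)
have sums n : series u n.+1 - series v n.+1 = z * series u n + c * z * series v n.
  elim: n => [|n IH].
    rewrite !seriesSr /series /= !big_geq // /u /v /qbinom_term !expr0.
    by rewrite !(mulr0, addr0, subrr).
  rewrite seriesSr [series v n.+2]seriesSr opprD addrACA IH step.
  by rewrite [series u n.+1]seriesSr [series v n.+1]seriesSr; ring.
have l1 : (fun n => series u n.+1 - series v n.+1) @ \oo -->
    qbinom_sum z - qbinom_sum (q * z).
  by apply: cvgB; rewrite (cvg_shiftS (series _)).
have l2 : (fun n => series u n.+1 - series v n.+1) @ \oo -->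
    z * qbinom_sum z + c * z * qbinom_sum (q * z).
  by under eq_fun do rewrite sums; apply: cvgD; exact: cvgMr.
have e : qbinom_sum z - qbinom_sum (q * z) =
    z * qbinom_sum z + c * z * qbinom_sum (q * z).
  exact: cvg_unique l1 l2.
lra.
Qed.

Lemma qbinom_sum_iter z N : 0 <= z -> z < 1 ->
  P (- z) N * qbinom_sum z = P (c * z) N * qbinom_sum (q ^+ N * z).
Proof.
move=> z0 z1; elim: N => [|N IH]; first by rewrite !qprod_fin0 expr0 !mul1r.
have /andP[Q0 Q1] := qpow_in01 q_gt0 q_lt1 N.
have w0 : 0 <= q ^+ N * z by rewrite mulr_ge0 // ltW.
have w1 : q ^+ N * z < 1 by rewrite (le_lt_trans _ z1) // ler_piMl.
rewrite !qprod_finS exprS -[q * _ * z]mulrA.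
transitivity ((1 - q ^+ N * z) * (P (- z) N * qbinom_sum z)); first by ring.
rewrite IH mulrCA (qbinom_sum_scale w0 w1); ring.
Qed.

Theorem qbinom_sumE z : 0 <= z -> z < 1 ->
  Pinf (- z) * qbinom_sum z = Pinf (c * z).
Proof.
move=> z0 z1.
(* Continuity at 0 along [q ^+ N * z]: these points lie in [[0, z]], so the series at [z] is a
   majorant. *)
have to1 : (fun N => qbinom_sum (q ^+ N * z)) @ \oo --> (1 : R).
  have qN N : 0 <= q ^+ N * z <= z.
    have /andP[Q0 Q1] := qpow_in01 q_gt0 q_lt1 N.
    by rewrite mulr_ge0 ?(ltW Q0) //= ler_piMl.
  have F1 : series (fun k => P c k / P (- q) k * 0 ^+ k) @ \oo --> (1 : R).
    have := @cvg_series_expr0 _ (fun k => P c k / P (- q) k).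
    by rewrite !qprod_fin0 divr1.
  apply: (@tannery_series _ (fun N => qbinom_term (q ^+ N * z)) _ _ _ _
    _ _ (is_cvg_qbinom_series z0 z1) _ _ F1).
  - by move=> m k; apply: qbinom_term_ge0; have /andP[] := qN m.
  - move=> m k; rewrite ler_wpM2l //.
    by have /andP[w0 wz] := qN m; rewrite lerXn2r ?nnegrE.
  - move=> k; apply: cvgMr.
    have c0 : (fun N => q ^+ N * z) @ \oo --> (0 : R).
      rewrite -[X in _ --> X](mul0r z); apply: cvgMl.
      by apply: cvg_expr; rewrite gtr0_norm.
    exact: (cvg_comp _ _ c0 (@exprn_continuous R k 0)).
  - move=> m; have /andP[w0 wz] := qN m.
    by apply: is_cvg_qbinom_series => //; exact: le_lt_trans z1.
have z1' : -1 < - z by rewrite ltrN2.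
have cz1 : -1 < c * z by rewrite (@lt_le_trans _ _ 0) ?ltrN10 ?mulr_ge0.
have l1 : (fun N => P (- z) N * qbinom_sum z) @ \oo --> Pinf (- z) * qbinom_sum z.
  by apply: cvgMl; exact: cvg_qprod_fin.
have l2 : (fun N => P (- z) N * qbinom_sum z) @ \oo --> Pinf (c * z) * 1.
  under eq_fun do rewrite qbinom_sum_iter //.
  by apply: cvgM => //; exact: cvg_qprod_fin.
by rewrite -[RHS]mulr1; exact: cvg_unique l1 l2.
Qed.

End QBinomial.

(** * The bilateral series as a limit of shifted q-binomial series *)

Section RamanujanPsi.
Variables (R : realType) (q a z : R).
Hypotheses (q_gt0 : 0 < q) (q_lt1 : q < 1) (a_gt0 : 0 < a).
Hypotheses (z_gt0 : 0 < z) (z_lt1 : z < 1).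
Local Notation P := (qprod_fin q).
Local Notation Pinf := (qprod_inf q).

Let q_neq0 : q != 0. Proof. exact: lt0r_neq0. Qed.
Let q_gtN1 : -1 < - q. Proof. by rewrite ltrN2. Qed.
Let q_le0 : - q <= 0. Proof. by rewrite oppr_le0 ltW. Qed.
Let gtN1 (c : R) : 0 < c -> -1 < c.
Proof. by move=> c0; rewrite (lt_trans _ c0) // ltrN10. Qed.
Let P_gt0 c N : 0 < c -> 0 < P c N.
Proof. by move=> c0; rewrite qprod_fin_gt0 // gtN1. Qed.
Let Pq_gt0 N : 0 < P (- q) N. Proof. exact: qprod_fin_gt0. Qed.
Let b_gt0 m : 0 < q ^- m * a. Proof. by rewrite mulr_gt0 // invr_gt0 exprn_gt0. Qed.

Let upos n : R := z ^+ n * P a n.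
Let uneg j : R := z ^- j.+1 * (P (q ^- j.+1 * a) j.+1)^-1.

(* The series of the q-binomial theorem for [c = q ^- m * a], normalised so
   that its term of index [m + n] tends, as [m] grows, to the term of index
   [n] of the bilateral series. *)
Let w m k : R := P (- q) m / (P (q ^- m * a) m * z ^+ m) *
  qbinom_term q (q ^- m * a) z k.

Let w_ge0 m k : 0 <= w m k.
Proof.
rewrite mulr_ge0 ?qbinom_term_ge0 // ?(ltW z_gt0) ?(ltW (b_gt0 _)) //.
by rewrite divr_ge0 ?mulr_ge0 ?exprn_ge0 // ltW // P_gt0.
Qed.

Let qpow_cancel m c : q ^+ m * (q ^- m * c) = c.
Proof. by rewrite mulrA mulfV ?mul1r // expf_neq0. Qed.

(** The first [m] factors of the numerator cancel the normalisation, and the remaining ones form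
    [P a n]. *)
Let w_addr m n : w m (m + n) = upos n * (P (- q) m / P (- q) (m + n)).
Proof.
rewrite /w /qbinom_term /upos (qprod_finD _ (q ^- m * a)) qpow_cancel exprD.
have h1 : P (q ^- m * a) m != 0 by rewrite gt_eqF // P_gt0.
have h2 : P (- q) (m + n) != 0 by rewrite gt_eqF.
have h3 : z ^+ m != 0 by rewrite expf_neq0 // gt_eqF.
by field; rewrite h1 h2 h3.
Qed.

(** With [m = i + j + 1], the term of index [i] has bilateral index [-(j + 1)]: the last [j + 1]
    factors of the normalisation survive in the denominator. *)
Let w_addl i j :
  w (i + j.+1) i = uneg j * (P (- q) (i + j.+1) / P (- q) i).
Proof.
rewrite /w /qbinom_term /uneg (qprod_finD _ (q ^- _ * a)).
have -> : q ^+ i * (q ^- (i + j.+1) * a) = q ^- j.+1 * a.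
  by rewrite exprD invfM -[_ / _ * a]mulrA qpow_cancel.
rewrite [z ^+ (i + _)]exprD.
have h1 : P (q ^- (i + j.+1) * a) i != 0 by rewrite gt_eqF // P_gt0.
have h2 : P (- q) i != 0 by rewrite gt_eqF.
have h3 k : z ^+ k != 0 by rewrite expf_neq0 // gt_eqF.
have h4 : P (q ^- j.+1 * a) j.+1 != 0 by rewrite gt_eqF // P_gt0.
move: (z ^+ j.+1) (h3 j.+1) (P _ i) h1 (P _ j.+1) h4 => t t0 b b0 c c0.
by field; rewrite b0 c0 h2 h3 t0.
Qed.

(** The sum of [w m] after product reversal: [m] enters only as the length of products with fixed
    parameters, so the limit can be read off. *)
Let rhs m : R :=
  P (- q) m * P (q / (a * z)) m / P (q / a) m * (Pinf (a * z) / Pinf (- z)).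

Let cvg_series_w m : series (w m) @ \oo --> rhs m.
Proof.
have b0 := ltW (b_gt0 m); have z0 := ltW z_gt0.
have az0 : 0 < a * z by rewrite mulr_gt0.
have -> : rhs m = P (- q) m / (P (q ^- m * a) m * z ^+ m) *
    qbinom_sum q (q ^- m * a) z.
  have Pz0 : Pinf (- z) != 0 by rewrite gt_eqF // qprod_inf_gt0 // ltrN2.
  have -> : qbinom_sum q (q ^- m * a) z = Pinf (q ^- m * a * z) / Pinf (- z).
    by rewrite -(qbinom_sumE q_gt0 q_lt1 b0 z0 z_lt1) mulrAC mulfV // mul1r.
  rewrite -[_ * a * z]mulrA (qprod_infD q_gt0 q_lt1 m); last first.
    by rewrite gtN1 // mulr_gt0 // invr_gt0 exprn_gt0.
  rewrite qpow_cancel.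
  (* Reversal for both [a * z] and [a] yields the same powers of [q] and the same [a ^+ m], which
     cancel; [z ^+ m] cancels against the normalisation. *)
  rewrite !(qprod_fin_reverse q_gt0) ?gt_eqF // exprMn /rhs.
  have h1 : P (q / a) m != 0 by rewrite gt_eqF // P_gt0 // divr_gt0.
  have h2 : \prod_(0 <= i < m) q ^- i.+1 != 0.
    by rewrite prodf_seq_neq0; apply/allP => i _; rewrite invr_neq0 // expf_neq0.
  have h3 : z ^+ m != 0 by rewrite expf_neq0 // gt_eqF.
  have h4 : a ^+ m != 0 by rewrite expf_neq0 // gt_eqF.
  by field; rewrite Pz0 h1 h2 h3 h4.
rewrite [w m](_ : _ = (P (- q) m / (P (q ^- m * a) m * z ^+ m)) *:
  qbinom_term q (q ^- m * a) z) //.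
by rewrite seriesZ; apply: cvgZr; exact: is_cvg_qbinom_series.
Qed.

Let cvg_Pq_ratio (c : R) (f g : nat -> nat) :
  f @ \oo --> \oo -> g @ \oo --> \oo ->
  (fun m => c * (P (- q) (f m) / P (- q) (g m))) @ \oo --> c.
Proof.
move=> ff gg; rewrite -[X in _ --> X]mulr1; apply: cvgMr.
have Pq0 : Pinf (- q) != 0 by rewrite gt_eqF // qprod_inf_gt0.
rewrite -(mulfV Pq0); apply: cvgM.
  exact: cvg_comp ff (cvg_qprod_fin q_gt0 q_lt1 q_gtN1).
by apply: cvgV => //; exact: cvg_comp gg (cvg_qprod_fin q_gt0 q_lt1 q_gtN1).
Qed.

(** Supplies the majorants [upos n / Pinf (- q)] and [uneg j / Pinf (- q)] for dominated
    convergence. *)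
Let Pq_ratio_le i k : P (- q) i / P (- q) k <= (Pinf (- q))^-1.
Proof.
rewrite -[leRHS]mul1r; apply: ler_pM; rewrite ?invr_ge0 ?(ltW (Pq_gt0 _)) //.
  by have := qprod_fin_ni q_gt0 q_lt1 q_gtN1 q_le0 (leq0n i); rewrite qprod_fin0.
by rewrite lef_pV2 ?posrE ?qprod_inf_gt0 // qprod_inf_le_fin.
Qed.

Let Pq_ratio_ge i k : Pinf (- q) <= P (- q) i / P (- q) k.
Proof.
rewrite ler_pdivlMr //; apply: le_trans (qprod_inf_le_fin _ _ i q_gtN1 q_le0) => //.
rewrite ler_piMr //; first by rewrite ltW // qprod_inf_gt0.
by have := qprod_fin_ni q_gt0 q_lt1 q_gtN1 q_le0 (leq0n k); rewrite qprod_fin0.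
Qed.

Let upos_ge0 n : 0 <= upos n.
Proof. by rewrite mulr_ge0 ?exprn_ge0 ?(ltW z_gt0) // ltW // P_gt0. Qed.

Let uneg_ge0 n : 0 <= uneg n.
Proof.
by rewrite mulr_ge0 // ?invr_ge0 ?exprn_ge0 ?(ltW z_gt0) // ltW // P_gt0.
Qed.

Let is_cvg_upos : cvgn (series upos).
Proof.
apply: (@series_le_cvg _ _ (geometric (Pinf a) z)) => //.
- move=> n /=; rewrite mulr_ge0 ?exprn_ge0 ?(ltW z_gt0) //.
  by rewrite ltW // qprod_inf_gt0 // gtN1.
- move=> n /=; rewrite /upos mulrC ler_wpM2r ?exprn_ge0 ?(ltW z_gt0) //.
  by rewrite qprod_fin_le_inf // ltW.
- by apply: is_cvg_geometric_series; rewrite gtr0_norm.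
Qed.

(** The first [m] terms of [w m] in reverse order, padded with zeros, so that [j] stands for the
    bilateral index [-(j + 1)] whatever [m] is. *)
Let wneg m j : R := if (j < m)%N then w m (m - j.+1) else 0.

Let wneg_ge0 m j : 0 <= wneg m j.
Proof. by rewrite /wneg; case: ifP. Qed.

Let wnegE m j : (j < m)%N ->
  wneg m j = uneg j * (P (- q) m / P (- q) (m - j.+1)).
Proof.
move=> jm; rewrite /wneg jm.
by have := w_addl (m - j.+1) j; rewrite subnK.
Qed.

Let series_wneg m : series (wneg m) m = series (w m) m.
Proof.
rewrite /series /= [RHS]big_nat_rev /= add0n; apply: eq_big_nat => i /andP[_ im].
by rewrite /wneg im.
Qed.

Let cvg_series_wneg m : series (wneg m) @ \oo --> series (w m) m.
Proof.
rewrite -(cvg_shiftn m (series _)) /=.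
suff -> : (fun n => series (wneg m) (n + m)) = fun=> series (w m) m.
  exact: cvg_cst.
apply/funext => n; rewrite series_addn series_wneg [X in _ + X]big1_seq ?addr0 //.
move=> k; rewrite mem_index_iota => /andP[_ /andP[mk _]].
by rewrite /wneg ltnNge mk.
Qed.

Let series_w_le m n : series (w m) n <= rhs m.
Proof.
have nd : nondecreasing_seq (series (w m)) by exact: nondecreasing_series.
by have := nondecreasing_cvgn_le nd (cvgP _ (@cvg_series_w m)) n;
  rewrite (cvg_lim _ (@cvg_series_w m)).
Qed.

Let cvg_rhs : rhs @ \oo -->
  Pinf (- q) * Pinf (q / (a * z)) / Pinf (q / a) * (Pinf (a * z) / Pinf (- z)).
Proof.
have qa0 : 0 < q / a by rewrite divr_gt0.
have qaz0 : 0 < q / (a * z) by rewrite divr_gt0 // mulr_gt0.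
apply: cvgMl; apply: cvgM; last first.
  apply: cvgV; first by rewrite gt_eqF // qprod_inf_gt0 // gtN1.
  by apply: cvg_qprod_fin => //; exact: gtN1.
by apply: cvgM; apply: cvg_qprod_fin => //; exact: gtN1.
Qed.

(** By [Pq_ratio_ge], [Pinf (- q)] times the partial sum of length [m] is at most the sum of the
    first [m] terms of [w m], hence at most [rhs m]; and [rhs] is bounded because it converges. *)
Let is_cvg_uneg : cvgn (series uneg).
Proof.
have [M rM] : exists M, forall m, rhs m <= M.
  have /cvg_has_ub[M MP] := cvgP _ cvg_rhs; exists M => m.
  by apply: le_trans (ler_norm _) _; apply: MP; exists m.
have Pq0 : 0 < Pinf (- q) by rewrite qprod_inf_gt0.
apply: (@series_le_is_cvg _ _ (M / Pinf (- q))) => // m.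
rewrite ler_pdivlMr //.
apply: le_trans (rM m); apply: le_trans (series_w_le m m).
rewrite -series_wneg /series /= mulr_suml; apply: ler_sum_nat => j /andP[_ jm].
by rewrite wnegE // ler_wpM2l.
Qed.

Lemma ramanujan_psi_cvg : cvgn (series upos) /\ cvgn (series uneg).
Proof. by []. Qed.

(** Split the sum [rhs m] of [w m] at index [m]: the first [m] terms tend to the negative half, the
    rest to the positive half. *)
Lemma ramanujan_psi_sum :
  limn (series upos) + limn (series uneg) =
  Pinf (- q) * Pinf (q / (a * z)) / Pinf (q / a) * (Pinf (a * z) / Pinf (- z)).
Proof.
have scaled (u : R^nat) : cvgn (series u) -> cvgn (series (fun n => u n / Pinf (- q))).
  move=> cu; rewrite (_ : (fun n => _) = (Pinf (- q))^-1 *: u); last first.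
    by apply/funext => n /=; rewrite mulrC.
  exact: is_cvg_seriesZ.
have Lneg : (fun m => series (w m) m) @ \oo --> limn (series uneg).
  apply: (@tannery_series _ wneg uneg _ _ _ wneg_ge0 _
    (scaled _ is_cvg_uneg)) => //.
  - move=> m j; have [jm|jm] := ltnP j m; first by rewrite wnegE // ler_wpM2l.
    rewrite /wneg ltnNge jm /= divr_ge0 // ltW // qprod_inf_gt0 //.
  (* The padding zeros occur only for [m <= j]; shifting by [j + 1] skips them. *)
  - move=> j; rewrite -(cvg_shiftn j.+1) /=.
    under eq_fun do rewrite wnegE ?leq_addl // addnK.
    by apply: cvg_Pq_ratio; [exact: cvg_addnr|exact: cvg_id].
have Lpos : (fun m => rhs m - series (w m) m) @ \oo --> limn (series upos).
  apply: (@tannery_series _ (fun m n => w m (m + n)) upos _ _ _ _ _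
    (scaled _ is_cvg_upos)) => //.
  - by move=> m n; rewrite w_addr ler_wpM2l.
  - move=> n; under eq_fun do rewrite w_addr.
    by apply: cvg_Pq_ratio; [exact: cvg_id|exact: cvg_addnr].
  - move=> m.
    have -> : series (fun n => w m (m + n)) =
        (fun N => series (w m) (N + m) - series (w m) m).
      apply/funext => N; rewrite series_addn addrC addKr /series /=.
      rewrite -[in RHS](add0n m) big_addn addnK.
      by apply: eq_bigr => i _; rewrite addnC.
    by apply: cvgB; [rewrite (cvg_shiftn m (series _))|exact: cvg_cst].
have rhsE : rhs = (fun m => (rhs m - series (w m) m) + series (w m) m).
  by apply/funext => m; rewrite subrK.
have L : rhs @ \oo --> limn (series upos) + limn (series uneg).
  by rewrite rhsE; exact: cvgD.
exact: cvg_unique L cvg_rhs.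
Qed.

End RamanujanPsi.

(** * Specialisation to [a = 1 / A] and [z = q^t] *)

Theorem mainTheorem4 (R : realType) (q A t x : R)
  (hq0 : 0 < q) (hq1 : q < 1) (hA : 0 < A) (ht : 0 < t)
  (hx : x = - (q `^ t) / A) :
  bilateral_cvg (fun n : int => (- x) ^ n * A ^ n * qprod q (1 / A) n) /\
  qprod_inf q (- q) * qprod_inf q (- x) * qprod_inf q (- (q / x)) =
  qprod_inf q (q * A) * qprod_inf q (A * x) *
  bilateral_sum (fun n : int => (- x) ^ n * A ^ n * qprod q (1 / A) n).
Proof.
have z_gt0 : 0 < q `^ t by rewrite powR_gt0.
(* Here [0 < t] enters: the power function of exponent [t] is strictly increasing, and [1] is
   rewritten as its value at [1]. *)
have z_lt1 : q `^ t < 1.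
  have one_pow : 1 `^ t = 1 :> R by rewrite powR1.
  by rewrite -[ltRHS]one_pow gt0_ltr_powR // nnegrE ltW.
set z := q `^ t in hx z_gt0 z_lt1.
have A0 : A != 0 by rewrite gt_eqF.
have z0 : z != 0 by rewrite gt_eqF.
have a_gt0 : 0 < 1 / A by rewrite divr_gt0.
have a_gtN1 : -1 < 1 / A by rewrite (lt_trans _ a_gt0) // ltrN10.
have zE n : (- x) ^ n * A ^ n = z ^ n.
  by rewrite -expfzMl; congr (_ ^ n); rewrite hx; field.
have posE : (fun m : nat => (- x) ^ m%:Z * A ^ m%:Z * qprod q (1 / A) m%:Z) =
    (fun m => z ^+ m * qprod_fin q (1 / A) m).
  by apply/funext => m; rewrite zE qprodE_nat.
have negE : (fun m : nat =>
      (- x) ^ (- m.+1%:Z) * A ^ (- m.+1%:Z) * qprod q (1 / A) (- m.+1%:Z)) =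
    (fun m => z ^- m.+1 * (qprod_fin q (q ^- m.+1 * (1 / A)) m.+1)^-1).
  by apply/funext => m; rewrite zE qprodE_neg ?(ltW a_gt0) // -exprnN.
rewrite /bilateral_cvg /bilateral_sum posE negE.
split; first exact: (ramanujan_psi_cvg hq0 hq1 a_gt0 z_gt0 z_lt1).
rewrite (ramanujan_psi_sum hq0 hq1 a_gt0 z_gt0 z_lt1).
have -> : q / (1 / A * z) = - (q / x) by rewrite hx; field; rewrite A0 z0.
have -> : q / (1 / A) = q * A by field.
have -> : 1 / A * z = - x by rewrite hx; field.
have -> : A * x = - z by rewrite hx; field.
(* The prefactors [Pinf (q A)] and [Pinf (A x)] are exactly the denominators of the summation
   formula, so they cancel once nonzero. *)
have h1 : qprod_inf q (q * A) != 0.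
  by rewrite gt_eqF // qprod_inf_gt0 // (@lt_trans _ _ 0) ?ltrN10 ?mulr_gt0.
have h2 : qprod_inf q (- z) != 0 by rewrite gt_eqF // qprod_inf_gt0 // ltrN2.
by field; rewrite h1 h2.
Qed.
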